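(* Let $R$ be a (not necessarily commutative) principal ideal domain with infinitely many distinct maximal (two-sided) ideals. Then the polynomial ring $R[x_1,\dots,x_n]$ over $R$ in central indeterminates $x_1,\dots,x_n$ is an Amitsur--Small extension of $R$; consequently, for every maximal left ideal $M$ of $R[x_1,\dots,x_n]$, we have $M\cap R\neq 0$.
   Context: All rings are unital and associative, not necessarily commutative. A principal ideal domain (PID) is a (not necessarily commutative) domain in which every left ideal and every right ideal is principal. ''Maximal ideal'' means maximal two-sided ideal. A term order on $\mathbb{N}^n$ (with $0\in\mathbb{N}$) is a well-order $<$ such that $(0,\dots,0)<\mathbf{i}$ for all $\mathbf{i}\neq(0,\dots,0)$, and $\mathbf{i}<\mathbf{j}$ implies $\mathbf{i}+\mathbf{k}<\mathbf{j}+\mathbf{k}$ for all $\mathbf{k}$. Write $\mathbf{x}^{\mathbf{i}}=x_1^{i_1}\cdots x_n^{i_n}$. Let $R$ be a subring of a ring $S$ and $x_1,\dots,x_n\in S$. $S$ is a skew polynomial ring over $R$ in variables $x_1,\dots,x_n$, written $S=R[x_1,\dots,x_n;<]$, if (1) $S$ is a free left $R$-module with basis $\{\mathbf{x}^{\mathbf{i}}\}_{\mathbf{i}\in\mathbb{N}^n}$, and (2) there is a term order $<$ on $\mathbb{N}^n$ with respect to which $\operatorname{le}(fg)=\operatorname{le}(f)+\operatorname{le}(g)$ for all nonzero $f,g\in S$. Here, for nonzero $f=r_1\mathbf{x}^{\mathbf{i}_1}+\cdots+r_m\mathbf{x}^{\mathbf{i}_m}$ with all $r_k\in R\setminus\{0\}$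 and $\mathbf{i}_1<\dots<\mathbf{i}_m$, the leading exponent is $\operatorname{le}(f)=\mathbf{i}_m$ and the leading term is $\operatorname{lt}(f)=r_m\mathbf{x}^{\mathbf{i}_m}$. For each $i$ there is a unique ring endomorphism $\sigma_i:R\to R$ (a structural endomorphism) with $\operatorname{lt}(x_ir)=\sigma_i(r)x_i$ for all nonzero $r\in R$. For $\mathbf{i}=(i_1,\dots,i_n)$ put $\sigma^{\mathbf{i}}=\sigma_1^{i_1}\cdots\sigma_n^{i_n}$ (composition). For $A\subseteq R$ and $r\in R$ put $(A:r)=\{s\in R\mid sr\in A\}$. $S=R[x_1,\dots,x_n;<]$ is an Amitsur--Small extension of $R$ if for every family $\{I_{\mathbf{i}}\}_{\mathbf{i}\in\mathbb{N}^n}$ of left ideals of $R$ with $\sigma^{\mathbf{j}}(I_{\mathbf{i}})\subseteq I_{\mathbf{i}+\mathbf{j}}$ for all $\mathbf{i},\mathbf{j}$, there is a nonzero $r\in R$ that is not left invertible, with $rS\subseteq Sr$ and $(I_{\mathbf{i}}:\sigma^{\mathbf{i}}(r))\subseteq(rI_{\mathbf{i}}:\sigma^{\mathbf{i}}(r))$ for all $\mathbf{i}\in\mathbb{N}^n$. The polynomial ring $R[x_1,\dots,x_n]$ in central indeterminates is regarded as a skew polynomial ring over $R$ in $x_1,\dots,x_n$ with respect to any term order; its structural endomorphisms are all the identity. *)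

(* Defs.v *)
From HB Require Import structures.
From mathcomp Require Import all_boot all_order all_algebra.
From mathcomp Require Import boolp classical_sets functions cardinality.
From mathcomp Require Import mpoly.

Set Implicit Arguments.
Unset Strict Implicit.
Unset Printing Implicit Defensive.

Import GRing.Theory.

Local Open Scope classical_set_scope.
Local Open Scope ring_scope.

(* One-sided and two-sided ideals of a noncommutative ring; improper ideals
   are allowed. Closure under subtraction follows by taking a = -1. *)
Definition left_ideal (R : nzRingType) (I : set R) : Prop :=
  I 0 /\ (forall a u v, I u -> I v -> I (a * u + v)).

Definition right_ideal (R : nzRingType) (I : set R) : Prop :=
  I 0 /\ (forall a u v, I u -> I v -> I (u * a + v)).

Definition two_sided_ideal (R : nzRingType) (I : set R) : Prop :=
  left_ideal I /\ right_ideal I.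

Definition maximal_among (R : nzRingType) (P : set R -> Prop) (M : set R) :
    Prop :=
  [/\ P M, M <> setT &
      forall J : set R, P J -> M `<=` J -> J = M \/ J = setT].

Definition maximal_left_ideal (R : nzRingType) (M : set R) : Prop :=
  maximal_among (@left_ideal R) M.

Definition maximal_ideal (R : nzRingType) (M : set R) : Prop :=
  maximal_among (@two_sided_ideal R) M.

Definition noncommutative_PID (R : nzRingType) : Prop :=
  [/\ GRing.integral_domain_axiom R,
      forall I : set R, left_ideal I ->
        exists a, I = [set s * a | s in [set: R]] &
      forall I : set R, right_ideal I ->
        exists a, I = [set a * s | s in [set: R]]].

Definition term_order (n : nat) (lt : rel 'X_{1..n}) : Prop :=
  [/\ [/\ irreflexive lt, transitive lt &
          forall i j : 'X_{1..n}, i != j -> lt i j || lt j i],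
      well_founded (fun i j : 'X_{1..n} => lt i j),
      forall i : 'X_{1..n}, i != 0%MM -> lt 0%MM i &
      forall i j k : 'X_{1..n}, lt i j -> lt (i + k)%MM (j + k)%MM].

(* Throughout, R is viewed as a subring of S through the ring morphism iota,
   so that iota r * f is the scalar action of r on f in the left R-module S. *)

(* The order of the factors matters: S need not be commutative. *)
Definition monomial (S : nzRingType) (n : nat) (x : 'I_n -> S)
    (m : 'X_{1..n}) : S :=
  \prod_(i < n) x i ^+ m i.

Definition monomial_basis (R S : nzRingType) (iota : {rmorphism R -> S})
    (n : nat) (x : 'I_n -> S) : Prop :=
  (forall f : S, exists (s : seq 'X_{1..n}) (c : 'X_{1..n} -> R),
      f = \sum_(m <- s) iota (c m) * monomial x m) /\
  (forall (s : seq 'X_{1..n}) (c : 'X_{1..n} -> R), uniq s ->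
      \sum_(m <- s) iota (c m) * monomial x m = 0 ->
      forall m, m \in s -> c m = 0).

(* leading_term lt iota x f r m: lt(f) = r x^m and le(f) = m. The list
   rcons s (r, m) gives the coefficients and exponents of f, in increasing
   order of the exponents. *)
Definition leading_term (n : nat) (lt : rel 'X_{1..n}) (R S : nzRingType)
    (iota : {rmorphism R -> S}) (x : 'I_n -> S)
    (f : S) (r : R) (m : 'X_{1..n}) : Prop :=
  exists s : seq (R * 'X_{1..n}),
    let t := rcons s (r, m) in
    [/\ f = \sum_(p <- t) iota p.1 * monomial x p.2,
        all (fun p => p.1 != 0) t &
        sorted lt [seq p.2 | p <- t]].

Definition leading_exponent (n : nat) (lt : rel 'X_{1..n}) (R S : nzRingType)
    (iota : {rmorphism R -> S}) (x : 'I_n -> S)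
    (f : S) (m : 'X_{1..n}) : Prop :=
  exists r : R, leading_term lt iota x f r m.

(* S = R[x_1, ..., x_n; <] *)
Definition skew_polynomial_ring (n : nat) (lt : rel 'X_{1..n})
    (R S : nzRingType) (iota : {rmorphism R -> S}) (x : 'I_n -> S) : Prop :=
  [/\ term_order lt,
      injective iota,
      monomial_basis iota x &
      forall (f g : S) (i j : 'X_{1..n}), f != 0 -> g != 0 ->
        leading_exponent lt iota x f i -> leading_exponent lt iota x g j ->
        leading_exponent lt iota x (f * g) (i + j)%MM].

Definition structural_endomorphisms (n : nat) (lt : rel 'X_{1..n})
    (R S : nzRingType) (iota : {rmorphism R -> S}) (x : 'I_n -> S)
    (sigma : 'I_n -> {rmorphism R -> R}) : Prop :=
  forall (i : 'I_n) (r : R), r != 0 ->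
    leading_term lt iota x (x i * iota r) (sigma i r) U_(i)%MM.

(* sigma_1^(m_1) \o ... \o sigma_n^(m_n) *)
Definition sigma_pow (n : nat) (R : nzRingType)
    (sigma : 'I_n -> {rmorphism R -> R}) (m : 'X_{1..n}) : R -> R :=
  \big[(fun f g : R -> R => f \o g)/id]_(i < n) iter (m i) (sigma i).

Definition colon (R : nzRingType) (A : set R) (r : R) : set R :=
  [set s | A (s * r)].

(* The structural endomorphisms are determined by the skew polynomial ring,
   so the existential quantifier on sigma only names them. *)
Definition amitsur_small_extension (n : nat) (lt : rel 'X_{1..n})
    (R S : nzRingType) (iota : {rmorphism R -> S}) (x : 'I_n -> S) : Prop :=
  skew_polynomial_ring lt iota x /\
  exists sigma : 'I_n -> {rmorphism R -> R},
    structural_endomorphisms lt iota x sigma /\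
    forall I : 'X_{1..n} -> set R,
      (forall i, left_ideal (I i)) ->
      (forall i j, sigma_pow sigma j @` I i `<=` I (i + j)%MM) ->
      exists r : R,
        [/\ r != 0,
            ~ (exists s : R, s * r = 1),
            [set iota r * f | f in [set: S]] `<=`
              [set f * iota r | f in [set: S]] &
            forall i, colon (I i) (sigma_pow sigma i r) `<=`
              colon [set r * a | a in I i] (sigma_pow sigma i r)].

(* Main.v *)
(** If a left ideal I of a left noetherian ring fails to be "P-regular" (P s ⊆ I
    implies s ∈ I) for pairwise distinct maximal ideals P_0, P_1, ..., then the
    annihilators of the P_k in R/I form an infinite direct sum, which is absurd.
    Dickson's lemma reduces an ascending family I_i indexed by N^n to essentially
    one ideal, so some maximal P is regular for all the I_i at once. In a PID,
    P = Rr = rR for a single nonzero r, and regularity turns s r = r t ∈ I_i into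
    t ∈ I_i: this r is the required element.

    For a maximal left ideal M of S = R[x_1, ..., x_n], take r for the ideals of
    leading coefficients of M. Unless r ∈ M we have 1 - g r ∈ M for some g ∈ S. If
    g is not constant, the leading coefficient of g r lies in r I_i, so
    subtracting some r h with h ∈ M lowers the degree of g. This ends with
    1 - c r ∈ M ∩ R, nonzero because r is not left invertible. *)

Require Import Defs.
From HB Require Import structures.
From mathcomp Require Import all_boot all_order all_algebra.
From mathcomp Require Import boolp classical_sets functions cardinality.
From mathcomp Require Import mpoly.

Set Implicit Arguments.
Unset Strict Implicit.
Unset Printing Implicit Defensive.

Import Order.TTheory GRing.Theory.

Local Open Scope classical_set_scope.
Local Open Scope ring_scope.

(** * Dickson's lemma *)

(** Choose repeatedly an index at which [f] is minimal on the tail beyond the previous choice; each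
    value chosen is then a lower bound for all later ones. *)
Lemma nat_nondecreasing_subsequence (f : nat -> nat) :
  exists2 phi : nat -> nat,
    {homo phi : k l / (k < l)%N} & {homo f \o phi : k l / (k <= l)%N}.
Proof.
have tail_min N : exists k, (N <= k)%N /\ forall l, (N <= l)%N -> (f k <= f l)%N.
  have ex_val : exists v, `[< exists2 k, (N <= k)%N & f k = v >].
    by exists (f N); apply/asboolP; exists N.
  have [v /asboolP[k Nk <-] minv] := ex_minnP ex_val.
  exists k; split=> // l Nl; apply: minv; apply/asboolP; by exists l.
have [g gP] := choice tail_min.
pose phi := fix phi k := if k is k'.+1 then g (phi k').+1 else g 0%N.
exists phi; first by apply: homo_ltn => [? ? ?|k] /=;
  [exact: ltn_trans | have [] := gP (phi k).+1].
apply: homo_leq => [//|? ? ?|k /=]; first exact: leq_trans.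
have le_g N : (N <= g N)%N by have [] := gP N.
have [m ->] : exists m, phi k = g m by case: k => [|k]; eexists.
by have [_] := gP m; apply; apply: leq_trans (le_g m) (ltnW (le_g _)).
Qed.

Lemma dickson n (u : nat -> 'X_{1..n}) :
  exists2 phi : nat -> nat,
    {homo phi : k l / (k < l)%N} &
    forall k l, (k <= l)%N -> (u (phi k) <= u (phi l))%MM.
Proof.
(* Coordinates are treated one at a time: a further extraction keeps the coordinates already made
   monotone. *)
suff [phi phi_lt phi_le] : exists2 phi : nat -> nat,
    {homo phi : k l / (k < l)%N} &
    forall i, i \in enum 'I_n -> {homo (fun k => u (phi k) i) : k l / (k <= l)%N}.
  by exists phi => // k l kl; apply/mnm_lepP => i; apply: phi_le; rewrite ?mem_enum.
elim: (enum _) => [|i s [phi phi_lt phi_le]]; first by exists id.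
have [psi psi_lt psi_le] := nat_nondecreasing_subsequence (fun k => u (phi k) i).
exists (phi \o psi) => [k l /psi_lt/phi_lt //|j].
rewrite inE => /predU1P[-> //|/phi_le homo_j] k l kl /=.
by apply: homo_j; move: kl; rewrite leq_eqVlt => /predU1P[->|/psi_lt/ltnW].
Qed.

(** * Maximal ideals of left noetherian rings *)

Section LeftIdeals.

Variable R : nzRingType.
Implicit Types (I J P : set R).

Lemma left_ideal0 I : left_ideal I -> I 0.
Proof. by case. Qed.

Lemma left_idealD I u v : left_ideal I -> I u -> I v -> I (u + v).
Proof. by case=> _ IP Iu Iv; rewrite -[u]mul1r; apply: IP. Qed.

Lemma left_idealM I a u : left_ideal I -> I u -> I (a * u).
Proof. by case=> I0 IP Iu; rewrite -[_ * _]addr0; apply: IP. Qed.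

Lemma right_idealM I a u : right_ideal I -> I u -> I (u * a).
Proof. by case=> I0 IP Iu; rewrite -[_ * _]addr0; apply: IP. Qed.

Lemma left_ideal_proper I : left_ideal I -> I <> setT -> ~ I 1.
Proof.
move=> lI nT I1; apply: nT; rewrite -subTset => x _.
by rewrite -[x]mulr1; apply: left_idealM.
Qed.

Lemma two_sided_setI I J :
  two_sided_ideal I -> two_sided_ideal J -> two_sided_ideal (I `&` J).
Proof.
move=> [[I0 IL] [_ IR]] [[J0 JL] [_ JR]]; split; split=> // a u v [? ?] [? ?].
  by split; [apply: IL | apply: JL].
by split; [apply: IR | apply: JR].
Qed.

(** The sum [P + J] is a two-sided ideal strictly larger than [P], so it contains 1. *)
Lemma maximal_ideal_comaximal P J :
  maximal_ideal P -> two_sided_ideal J -> ~ J `<=` P ->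
  exists a b, [/\ P a, J b & a + b = 1].
Proof.
move=> [[[P0 PL] [_ PR]] _ Pmax] [[J0 JL] [_ JR]] nJP.
pose S := [set x | exists a b, [/\ P a, J b & a + b = x]].
have S_ideal : two_sided_ideal S.
  split; (split; first by exists 0, 0; rewrite addr0) => c _ _
    [a [b [Pa Jb <-]]] [a' [b' [Pa' Jb' <-]]].
  - exists (c * a + a'), (c * b + b'); split; [exact: PL | exact: JL |].
    by rewrite mulrDr addrACA.
  - exists (a * c + a'), (b * c + b'); split; [exact: PR | exact: JR |].
    by rewrite mulrDl addrACA.
have [|eqSP|eqST] := Pmax _ S_ideal.
- by move=> a Pa; exists a, 0; rewrite addr0.
- by case: nJP => b Jb; rewrite -eqSP; exists 0, b; rewrite add0r.
- by have : S 1 by rewrite eqST.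
Qed.

(** Otherwise [a + b = 1 = c + d] with [a], [c] in [P], [b] in [J] and [d] in [K]. Then
    [1 = a + b * c + b * d], and [b * d] lies in both [J] and [K], which puts 1 in [P]. *)
Lemma maximal_ideal_prime P J K : maximal_ideal P ->
  two_sided_ideal J -> two_sided_ideal K ->
  J `&` K `<=` P -> J `<=` P \/ K `<=` P.
Proof.
move=> Pmax Jid Kid JKP; apply: contrapT => /not_orP[nJP nKP].
have [a [b [Pa Jb ab1]]] := maximal_ideal_comaximal Pmax Jid nJP.
have [c [d [Pc Kd cd1]]] := maximal_ideal_comaximal Pmax Kid nKP.
case: (Pmax) => -[Pl Pr] PT _; apply: (left_ideal_proper Pl PT).
rewrite -ab1; apply: left_idealD => //; rewrite -[b]mulr1 -cd1 mulrDr.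
apply: left_idealD => //; first exact: left_idealM.
apply: JKP; split; [exact: right_idealM Jid.2 _ | exact: left_idealM Kid.1 _].
Qed.

Lemma maximal_ideal_incl P J :
  maximal_ideal P -> maximal_ideal J -> J `<=` P -> J = P.
Proof.
by move=> [Pid PT _] [_ _ Jmax] /(Jmax _ Pid)[].
Qed.

(** Asking for one stationary step amounts to the ascending chain condition, since a chain that
    never stabilizes has a strictly ascending subchain. *)
Definition left_noetherian : Prop :=
  forall J : nat -> set R, (forall k, left_ideal (J k)) ->
    (forall k, J k `<=` J k.+1) -> exists k, J k.+1 `<=` J k.

Lemma infinite_set_inj (A : set (set R)) : infinite_set A ->
  exists2 P : nat -> set R, injective P & forall k, A (P k).
Proof.
move=> /infiniteP/pcard_leP/unsquash f; exists f => [k l|k].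
  by apply: inj; rewrite inE.
exact: funS.
Qed.

Lemma noetherian_maximal_ideal_regular n (I : 'X_{1..n} -> set R) :
  left_noetherian -> infinite_set [set P : set R | maximal_ideal P] ->
  (forall i, left_ideal (I i)) -> (forall i j, I i `<=` I (i + j)%MM) ->
  exists2 P, maximal_ideal P &
    forall i s, (forall p, P p -> I i (p * s)) -> I i s.
Proof.
move=> noeth infmax Ileft Imono; apply: contrapT => noP.
have [Q Q_inj Qmax] := infinite_set_inj infmax.
have bad k : exists w : 'X_{1..n} * R,
    (forall p, Q k p -> I w.1 (p * w.2)) /\ ~ I w.1 w.2.
  apply: contrapT => nobad; apply: noP; exists (Q k); first exact: Qmax.
  move=> i s Qs; apply: contrapT => nIs; apply: nobad; by exists (i, s).
have [w wP] := choice bad.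
(* Along [phi] the exponents of the witnesses ascend, so the ideals at those exponents form a chain
   [L] although [I] is indexed by a partial order. *)
have [phi phi_lt phi_le] := dickson (fun k => (w k).1).
pose P k := Q (phi k); pose L k := I (w (phi k)).1.
have Lmono k : L k `<=` L k.+1.
  by rewrite /L -(submK (phi_le _ _ (leqnSn k))) addmC; apply: Imono.
pose cap := fix cap k := if k is k'.+1 then cap k' `&` P k else P 0%N.
have cap_ideal k : two_sided_ideal (cap k).
  have Pid m : two_sided_ideal (P m) by case: (Qmax (phi m)).
  by elim: k => [|k IHk]; [exact: Pid | exact: two_sided_setI].
(* Distinct maximal ideals are incomparable, and by primeness a maximal ideal containing a finite
   intersection of two-sided ideals contains one of them. *)
have cap_incl k l : (k < l)%N -> ~ cap k `<=` P l.
  have Pne m : (m < l)%N -> ~ P m `<=` P l.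
    move=> ml /(maximal_ideal_incl (Qmax _) (Qmax _))/Q_inj eq_phi.
    by have := phi_lt _ _ ml; rewrite eq_phi ltnn.
  elim: k => [|k IHk] kl; first exact: Pne.
  case/(maximal_ideal_prime (Qmax _) (cap_ideal k)); first by case: (Qmax (phi k.+1)).
    exact/IHk/ltnW.
  exact: Pne.
(* Stationarity J k.+1 = J k forces s into L k.+1, since cap k and P k.+1 are
   comaximal. *)
pose J k := [set s | forall q, cap k q -> L k (q * s)].
have [k|k s Js q [capq _]|k Jk] := noeth J.
- split=> [q _|a u v Ju Jv q capq]; first by rewrite mulr0; case: (Ileft (w (phi k)).1).
  rewrite mulrDr mulrA; apply: left_idealD; [exact: Ileft | apply: Ju | exact: Jv].
  exact: right_idealM (cap_ideal k).2 _.
- exact/Lmono/Js.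
have [PwL nLw] := wP (phi k.+1).
set s := (w (phi k.+1)).2 in PwL nLw.
have Js : J k s by apply: Jk => q [_ Pq]; apply: PwL.
have [a [b [Pa capb ab1]]] := maximal_ideal_comaximal (Qmax _) (cap_ideal k)
  (cap_incl _ _ (ltnSn k)).
apply: nLw; rewrite -[s]mul1r -ab1 mulrDl; apply: left_idealD => //.
  exact: PwL.
exact/Lmono/Js.
Qed.

End LeftIdeals.

(** * Noncommutative principal ideal domains *)

Section PrincipalIdealDomain.

Variable R : nzRingType.
Hypothesis R_PID : noncommutative_PID R.

Lemma PID_mulf_eq0 (a b : R) : a * b = 0 -> a = 0 \/ b = 0.
Proof.
by case: R_PID => dom _ _ /dom/orP[/eqP ->|/eqP ->]; [left|right].
Qed.

Lemma PID_mulIf (a b c : R) : c != 0 -> a * c = b * c -> a = b.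
Proof.
move=> c0 /eqP; rewrite -subr_eq0 -mulrBl => /eqP/PID_mulf_eq0[/eqP|/eqP].
  by rewrite subr_eq0 => /eqP.
by rewrite (negPf c0).
Qed.

Lemma PID_mulfI (a b c : R) : c != 0 -> c * a = c * b -> a = b.
Proof.
move=> c0 /eqP; rewrite -subr_eq0 -mulrBr => /eqP/PID_mulf_eq0[/eqP|/eqP].
  by rewrite (negPf c0).
by rewrite subr_eq0 => /eqP.
Qed.

(** The union of the chain is principal, and the stage containing its generator is already the whole
    union. *)
Lemma PID_left_noetherian : left_noetherian R.
Proof.
move=> J Jleft Jmono.
have Jle k l : (k <= l)%N -> J k `<=` J l.
  by apply: (homo_leq (r := fun A B => A `<=` B)) k l => [A|B A C|//];
    [exact: subset_refl | exact: subset_trans].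
pose U := \bigcup_k J k.
have [|a Ua] := (let: And3 _ H _ := R_PID in H) U.
  split; first by exists 0%N => //; apply: left_ideal0.
  move=> a u v [k _ Ju] [l _ Jv]; exists (maxn k l) => //.
  apply: left_idealD => //; last exact: Jle (leq_maxr _ _) _ Jv.
  by apply: left_idealM => //; apply: Jle (leq_maxl _ _) _ Ju.
have [k _ Ja] : U a by rewrite Ua; exists 1; rewrite ?mul1r.
exists k => x Jx; have : U x by exists k.+1.
by rewrite Ua => -[s _ <-]; apply: left_idealM.
Qed.

(** With [P = R p = q R], write [q = u p]. It suffices that [u] is nonzero: for [x] in [P], [u x]
    lies in [q R = u p R], and cancelling [u] puts [x] in [p R]. *)
Lemma PID_two_sided_generator (P : set R) : two_sided_ideal P ->
  exists p, P = [set s * p | s in [set: R]] /\ P = [set p * s | s in [set: R]].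
Proof.
move=> [Pl Pr]; case: R_PID => _ /(_ P Pl)[p Pp] /(_ P Pr)[q Pq].
exists p; split=> //.
have Pp1 : P p by rewrite Pp; exists 1; rewrite ?mul1r.
have Pq1 : P q by rewrite Pq; exists 1; rewrite ?mulr1.
apply/seteqP; split=> [x Px|_ [s _ <-]]; last exact: right_idealM Pr _.
have [p0|p0] := eqVneq p 0.
  by move: Px; rewrite Pp p0 => -[s _ <-]; exists 0; rewrite ?mulr0.
have [u _ up] : [set s * p | s in setT] q by rewrite -Pp.
have [v _ qv] : [set q * s | s in setT] p by rewrite -Pq.
have [w _ wp] : [set s * p | s in setT] (p * v).
  by rewrite -Pp; apply: right_idealM Pr _.
(* Indeed [u w p = u p v = q v = p], and [p] cancels. *)
have uw : u * w = 1.
  by apply: (PID_mulIf p0); rewrite -mulrA wp mulrA up qv mul1r.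
have u0 : u != 0 by apply: contra_eq_neq uw => ->; rewrite mul0r eq_sym oner_eq0.
have [t _ qt] : [set q * s | s in setT] (u * x).
  by rewrite -Pq; apply: left_idealM Pl _.
by exists t => //; apply: (PID_mulfI u0); rewrite mulrA up.
Qed.

(** The element [r] generates, on both sides, a maximal ideal regular for all [I i]. The last clause
    is the colon condition for identity structural endomorphisms. *)
Lemma PID_normal_regular n (I : 'X_{1..n} -> set R) :
  infinite_set [set P : set R | maximal_ideal P] ->
  (forall i, left_ideal (I i)) -> (forall i j, I i `<=` I (i + j)%MM) ->
  exists r : R,
    [/\ r != 0, ~ (exists s, s * r = 1), forall a, exists b, r * a = b * r &
        forall i s, I i (s * r) -> exists2 a, I i a & r * a = s * r].
Proof.
move=> infmax Ileft Imono.
have [P Pmax Preg] :=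
  noetherian_maximal_ideal_regular PID_left_noetherian infmax Ileft Imono.
case: (Pmax) => -[Pl Pr] PT _.
have [r [Prl Prr]] := PID_two_sided_generator (conj Pl Pr).
have lP s : P (s * r) by rewrite Prl; exists s.
have rP s : P (r * s) by rewrite Prr; exists s.
exists r; split.
(* If [r = 0], then [P = 0] lies in every maximal ideal and is therefore the only one. *)
- apply: contra_not_neq infmax => r0.
  apply: (@sub_finite_set _ _ [set P]); last exact: finite_set1.
  move=> Q Qmax /=; symmetry; apply: (maximal_ideal_incl Qmax Pmax).
  by rewrite Prl r0 => _ [s _ <-]; rewrite mulr0; case: Qmax => -[[]].
- by case=> s sr1; apply: (left_ideal_proper Pl PT); rewrite -sr1.
- by move=> a; have := rP a; rewrite {1}Prl => -[b _ <-]; exists b.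
- move=> i s Isr; have := lP s; rewrite {1}Prr => -[a _ ra]; exists a => //.
  apply: Preg => p; rewrite Prl => -[t _ <-].
  by rewrite -mulrA ra; apply: left_idealM.
Qed.

End PrincipalIdealDomain.

(** * Leading terms for an arbitrary term order *)

Section LeadingTerms.

Variables (n : nat) (lt : rel 'X_{1..n}) (R : nzRingType).
Hypothesis lt_term : term_order lt.
Implicit Types (f g : {mpoly R[n]}) (i j k m : 'X_{1..n}).

Local Notation iota := (@mpolyC n R : {rmorphism R -> {mpoly R[n]}}).
Local Notation x := (fun i : 'I_n => 'X_i : {mpoly R[n]}).

Lemma monomialE m : monomial x m = 'X_[m].
Proof. by rewrite mpolyXE_id. Qed.

Lemma mcoeff_sum_monomial (s : seq 'X_{1..n}) (c : 'X_{1..n} -> R) m : uniq s ->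
  (\sum_(i <- s) iota (c i) * monomial x i)@_m = c m *+ (m \in s).
Proof.
move=> s_uniq; rewrite raddf_sum /=.
under eq_bigr => i _ do rewrite monomialE mcoeffCM mcoeffX.
have [ms|ms] := boolP (m \in s).
  rewrite (bigD1_seq m) //= eqxx mulr1 big1 ?addr0 // => i /negPf im.
  by rewrite im mulr0.
rewrite big_seq big1 // => i is_; have [im|] := eqVneq i m; last by rewrite mulr0.
by rewrite -im is_ in ms.
Qed.

Lemma mpoly_monomial_basis : monomial_basis iota x.
Proof.
split=> [f|s c s_uniq sum0 m ms].
  exists (msupp f), (fun m => f@_m); rewrite {1}[f]mpolyE.
  by apply: eq_bigr => m _; rewrite monomialE mul_mpolyC.
by have := mcoeff_sum_monomial c m s_uniq; rewrite sum0 mcoeff0 ms mulr1n.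
Qed.

Lemma term_lt_irr : irreflexive lt. Proof. by case: lt_term => -[]. Qed.

Lemma term_lt_trans : transitive lt. Proof. by case: lt_term => -[]. Qed.

Lemma term_lt_total i j : i != j -> lt i j || lt j i.
Proof. by case: lt_term => -[_ _ + _ _ _]; apply. Qed.

Lemma term_lt_addr i j k : lt i j -> lt (i + k)%MM (j + k)%MM.
Proof. by case: lt_term => _ _ _; apply. Qed.

(** Strictly increasing exponents are distinct, so each coefficient of [f] comes from at most one
    list entry. Conversely, the list is the sorted support with [m] moved to the end. *)
Lemma leading_termP f (r : R) m :
  leading_term lt iota x f r m <->
  [/\ r != 0, f@_m = r & forall k, k != m -> f@_k != 0 -> lt k m].
Proof.
split=> [[s [-> t_neq0 t_sorted]]|[r0 fm lt_m]].
  set t := rcons s (r, m) in t_neq0 t_sorted *.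
  have t_uniq : uniq [seq p.2 | p <- t].
    exact: sorted_uniq term_lt_trans term_lt_irr _ t_sorted.
  have coeft k : (\sum_(p <- t) iota p.1 * monomial x p.2)@_k =
      \sum_(p <- t | p.2 == k) p.1.
    rewrite raddf_sum /= [RHS]big_mkcond; apply: eq_bigr => p _.
    by rewrite monomialE mcoeffCM mcoeffX; case: eqP; rewrite ?mulr1 ?mulr0.
  move: t_uniq; rewrite /t map_rcons rcons_uniq => /andP[m_s _].
  split.
  - by move: t_neq0; rewrite /t all_rcons => /andP[].
  - rewrite coeft /t big_rcons /= eqxx big1_seq ?add0r // => p /andP[/eqP pm ps].
    by case/mapP: m_s; exists p.
  - move=> k km; rewrite coeft => nz.
    have [p ps pk] : exists2 p, p \in s & p.2 = k.
      apply: contra_notP (negP nz) => noK; rewrite /t big_rcons /= [m == k]eq_sym (negPf km) addr0.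
      by rewrite big1_seq // => p /andP[/eqP pk ps]; case: noK; exists p.
    move: t_sorted; rewrite /t map_rcons sorted_pairwise; last exact: term_lt_trans.
    rewrite pairwise_rcons => /andP[/allP all_lt _]; apply: all_lt.
    by apply/mapP; exists p.
(* Sorting needs a total relation, hence the reflexive closure; strictness is recovered from the
   distinctness of the exponents. *)
pose le i j := (i == j) || lt i j.
have le_total : total le.
  move=> i j; rewrite /le; have [->//|/term_lt_total] := eqVneq i j.
  by case/orP=> -> //; rewrite !orbT.
pose s := sort le (rem m (msupp f)).
have m_supp : m \in msupp f by rewrite mcoeff_msupp fm.
have s_uniq : uniq s by rewrite sort_uniq rem_uniq ?msupp_uniq.
have s_mem k : (k \in s) = (k != m) && (f@_k != 0).
  by rewrite mem_sort (mem_rem_uniq _ (msupp_uniq f)) inE mcoeff_msupp.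
exists [seq (f@_k, k) | k <- s]; rewrite -fm -(map_rcons (fun k => (f@_k, k))); split.
- rewrite big_map -cats1 big_cat big_seq1 /= {1}[f]mpolyE (big_rem m m_supp) /=.
  rewrite addrC monomialE mul_mpolyC; congr (_ + _).
  rewrite (perm_big s) ?(perm_sym _ s) ?perm_sort //=.
  by apply: eq_bigr => k _; rewrite monomialE mul_mpolyC.
- rewrite all_map all_rcons /= fm r0; apply/allP => k /=.
  by rewrite s_mem => /andP[].
rewrite -map_comp map_id sorted_pairwise; last exact: term_lt_trans.
rewrite pairwise_rcons; apply/andP; split.
  by apply/allP => k; rewrite s_mem => /andP[/lt_m lt_km /lt_km].
have le_trans : transitive le.
  move=> j i k; rewrite /le => /orP[/eqP->//|lt_ij] /orP[/eqP<-|lt_jk].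
    by rewrite lt_ij orbT.
  by rewrite (term_lt_trans lt_ij lt_jk) orbT.
have := sort_sorted le_total (rem m (msupp f)); rewrite sorted_pairwise // => le_s.
move: s_uniq; rewrite uniq_pairwise => neq_s.
have := conj le_s neq_s => /andP; rewrite -pairwise_relI.
by apply: sub_pairwise => i j /= /andP[/orP[/eqP->|//]]; rewrite eqxx.
Qed.

Lemma leading_exponentP f m :
  leading_exponent lt iota x f m <->
  f@_m != 0 /\ forall k, k != m -> f@_k != 0 -> lt k m.
Proof.
split=> [[r /leading_termP[r0 -> ?]]|[f0 lt_m]]; first by [].
by exists f@_m; apply/leading_termP.
Qed.

Lemma term_lt_addl i j k : lt i j -> lt (k + i)%MM (k + j)%MM.
Proof. by rewrite ![(k + _)%MM]addmC; apply: term_lt_addr. Qed.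

(** Every other pair of exponents from the supports has a sum strictly below [i + j], so the
    coefficient there is the single product [f@_i * g@_j], nonzero in a domain. *)
Lemma mpoly_leading_exponentM f g i j :
  GRing.integral_domain_axiom R ->
  leading_exponent lt iota x f i -> leading_exponent lt iota x g j ->
  leading_exponent lt iota x (f * g) (i + j)%MM.
Proof.
move=> dom /leading_exponentP[fi lt_i] /leading_exponentP[gj lt_j].
have lt_ij k l : f@_k != 0 -> g@_l != 0 -> (k, l) != (i, j) ->
    lt (k + l)%MM (i + j)%MM.
  move=> fk gl; have [->|ki] := eqVneq k i.
    by rewrite xpair_eqE eqxx => /lt_j/(_ gl)/term_lt_addl.
  have lt_ki := lt_i _ ki fk.
  have [->|/lt_j/(_ gl) lt_lj] := eqVneq l j; first by rewrite term_lt_addr.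
  by move=> _; apply: term_lt_trans (term_lt_addr _ lt_ki) (term_lt_addl _ lt_lj).
have coefM k : (f * g)@_k = \sum_(m <- allpairs pair (msupp f) (msupp g))
    f@_m.1 * g@_m.2 *+ ((m.1 + m.2)%MM == k).
  rewrite mpolyME raddf_sum /=; apply: eq_bigr => m _.
  by rewrite mcoeffZ mcoeffX; case: eqP; rewrite ?mulr1 ?mulr0.
have mem_fg k l : ((k, l) \in allpairs pair (msupp f) (msupp g)) =
    (f@_k != 0) && (g@_l != 0).
  apply/allpairsP/andP => [[[k' l'] /= [fk gl [-> ->]]]|[fk gl]].
    by rewrite -!mcoeff_msupp.
  by exists (k, l); rewrite /= !mcoeff_msupp.
apply/leading_exponentP; split=> [|k kij].
  rewrite coefM (bigD1_seq (i, j)) /=; first last.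
  - by apply: allpairs_uniq; rewrite ?msupp_uniq // => -[? ?] [? ?].
  - by rewrite mem_fg fi.
  rewrite eqxx big1_seq ?addr0 => [|[k l] /andP[kl]].
    by apply/negP => /eqP/dom; rewrite (negPf fi) (negPf gj).
  rewrite mem_fg => /andP[fk gl] /=; have := lt_ij _ _ fk gl kl.
  by case: eqP => // ->; rewrite term_lt_irr.
apply: contraR => not_lt; rewrite coefM big1_seq // => -[k' l] /andP[_].
rewrite mem_fg /= => /andP[fk gl]; case: eqP => // eq_k.
have [[? ?]|/lt_ij] := eqVneq (k', l) (i, j); first by subst; rewrite eqxx in kij.
by move=> /(_ fk gl); rewrite eq_k (negPf not_lt).
Qed.

End LeadingTerms.

(** * The polynomial ring as a skew polynomial ring with identity endomorphisms *)

Lemma sigma_pow_id n (R : nzRingType) (m : 'X_{1..n}) :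
  sigma_pow (fun _ : 'I_n => idfun : {rmorphism R -> R}) m = id.
Proof.
rewrite /sigma_pow; elim/big_ind: _ => // [f g -> -> //|i _].
by apply/funext => r; elim: (m i) => //= k ->.
Qed.

Lemma mpoly_skew_polynomial_ring n (lt : rel 'X_{1..n}) (R : nzRingType) :
  GRing.integral_domain_axiom R -> term_order lt ->
  skew_polynomial_ring lt (@mpolyC n R : {rmorphism R -> {mpoly R[n]}})
    (fun i : 'I_n => 'X_i).
Proof.
move=> dom lt_term; split=> //; first exact: can_inj (@mpolyCK n R).
  exact: mpoly_monomial_basis.
by move=> f g i j _ _; apply: mpoly_leading_exponentM.
Qed.

Lemma mpoly_structural_endomorphisms n (lt : rel 'X_{1..n}) (R : nzRingType) :
  term_order lt ->
  structural_endomorphisms lt (@mpolyC n R : {rmorphism R -> {mpoly R[n]}})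
    (fun i : 'I_n => 'X_i) (fun _ => idfun).
Proof.
move=> lt_term i r r0; apply/leading_termP => //=.
have coef k : ('X_i * r%:MP_[n])@_k = r * (U_(i)%MM == k)%:R.
  by rewrite -commr_mpolyX mcoeffCM mcoeffX.
split=> // [|k /negPf ki]; first by rewrite coef eqxx mulr1.
by rewrite coef [_ == k]eq_sym ki mulr0 eqxx.
Qed.

(** Monomials commute with constants, so [r] can be moved across [f] coefficient by coefficient. *)
Lemma mpoly_mulC_normal n (R : nzRingType) (r : R) (f : {mpoly R[n]}) :
  (forall a, exists b, r * a = b * r) ->
  exists g : {mpoly R[n]}, r%:MP * f = g * r%:MP.
Proof.
move=> /choice[rho rhoP]; exists (\sum_(m <- msupp f) (rho f@_m)%:MP * 'X_[m]).
rewrite {1}[f]mpolyE mulr_sumr mulr_suml; apply: eq_bigr => m _.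
by rewrite -mul_mpolyC mulrA -mpolyCM rhoP mpolyCM -!mulrA commr_mpolyX.
Qed.

Lemma mcoeffMC n (R : nzRingType) (f : {mpoly R[n]}) (r : R) m :
  (f * r%:MP)@_m = f@_m * r.
Proof.
rewrite {1}[f]mpolyE mulr_suml raddf_sum /= [in RHS](mpolyE f) raddf_sum mulr_suml.
apply: eq_bigr => k _; rewrite -mul_mpolyC -mulrA -commr_mpolyX /= !mcoeffCM.
by rewrite mcoeffX; case: eqP; rewrite !(mulr0, mulr1, mul0r).
Qed.

(** * Elimination in a left ideal *)

Section LeadingIdeals.

Variables (R : nzRingType) (n : nat) (M : set {mpoly R[n]}).
Hypothesis M_left : left_ideal M.

(* Here, and for mlead, exponents are compared in the library's own (degree) term
   order, as the claim on maximal left ideals mentions no order. *)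
Definition leading_ideal (i : 'X_{1..n}) : set R :=
  [set c | exists2 f, M f & f@_i = c /\ forall k, (i < k)%O -> f@_k = 0].

(** The coefficient at [i] is allowed to vanish, so cancellation in a sum is harmless. *)
Lemma leading_ideal_left i : left_ideal (leading_ideal i).
Proof.
split=> [|a _ _ [f Mf [<- f0]] [g Mg [<- g0]]].
  by exists 0; [exact: left_ideal0 | split=> *; rewrite mcoeff0].
exists (a%:MP * f + g).
  by apply: left_idealD => //; apply: left_idealM.
split=> [|k ik]; first by rewrite mcoeffD mcoeffCM.
by rewrite mcoeffD mcoeffCM f0 // g0 // mulr0 addr0.
Qed.

Lemma leading_ideal_mono i j : leading_ideal i `<=` leading_ideal (i + j)%MM.
Proof.
move=> _ [f Mf [<- f0]]; exists ('X_[j] * f); first exact: left_idealM.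
have coef k : ('X_[j] * f)@_(k + j)%MM = f@_k.
  by rewrite -commr_mpolyX addmC mcoeffMX.
split=> [|k ijk]; first exact: coef.
(* Exponents not divisible by [j] do not occur in ['X_[j] * f]; the others are shifts by [j] of
   exponents of [f]. *)
have [/submK kj|nkj] := boolP (j <= k)%MM.
  by rewrite -kj coef f0 // -(ltmc_add2l _ _ j) kj.
rewrite -commr_mpolyX; apply/eqP; rewrite mcoeff_eq0 (perm_mem (msuppMX _ _)); apply/mapP => -[l _ kl].
by move: nkj; rewrite kl lem_addr.
Qed.

Lemma leading_ideal_elimination (r : R) :
  (forall a, a * r = 0 -> a = 0) ->
  (forall a, exists b, r * a = b * r) ->
  (forall i s, leading_ideal i (s * r) ->
     exists2 a, leading_ideal i a & r * a = s * r) ->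
  forall g : {mpoly R[n]}, M (1 - g * r%:MP) -> exists c, M (1 - c * r)%:MP.
Proof.
move=> r_reg r_normal r_lead g.
move: {2}(mlead g) (erefl (mlead g)) => i.
elim/(well_founded_ind (@ltom_wf n)): i g => i IH g gi Mg.
have [i0|i_neq0] := eqVneq i 0%MM.
  exists (mcoeff 0%MM g); rewrite mpolyCB mpolyCM mpolyC1.
  suff <- : g = (mcoeff 0%MM g)%:MP by [].
  apply/mpolyP => k; rewrite mcoeffC; have [->|k0] := eqVneq k 0%MM.
    by rewrite mulr1.
  by rewrite mulr0 mcoeff_gt_mlead // gi i0 lt_neqAle eq_sym k0 le0m.
(* Since [i] is nonzero, the constant 1 does not affect the coefficients at or above [i]. *)
have lead_i : leading_ideal i (- g@_i * r).
  exists (1 - g * r%:MP) => //.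
  split=> [|k ik]; rewrite mcoeffB mcoeff1 mcoeffMC.
    by rewrite (negPf i_neq0) sub0r mulNr.
  rewrite mcoeff_gt_mlead ?gi // mul0r subr0.
  by case: eqP ik => // ->; rewrite ltNge le0m.
have [a [h Mh [hi h0]] ra] := r_lead _ _ lead_i.
(* Normality turns [r h] into [h' r], so that [1 - g r - r h], still in [M], becomes
   [1 - (g + h') r]. *)
have [h' rh] := mpoly_mulC_normal h r_normal.
have g'0 k : (i <= k)%O -> (g + h')@_k = 0.
  move=> ik; apply: r_reg; rewrite mcoeffD mulrDl -[h'@_k * r]mcoeffMC -rh mcoeffCM.
  move: ik; rewrite le_eqVlt => /predU1P[<-|ik].
    by rewrite hi ra mulNr subrr.
  by rewrite h0 // mulr0 addr0 mcoeff_gt_mlead ?gi // mul0r.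
apply: IH (erefl (mlead (g + h'))) _.
  (* If the exponent did not drop, the leading coefficient of [g + h'] would vanish, making it zero.
     But the zero polynomial has [mlead] 0, which is below the nonzero [i]. *)
  rewrite ltNge; apply: contra i_neq0 => le_i.
  move/eqP: (g'0 _ le_i); rewrite mleadc_eq0 => /eqP g'_eq0.
  by move: le_i; rewrite g'_eq0 mlead0 le_eqVlt ltNge le0m orbF.
rewrite mulrDl opprD addrA -rh; apply: left_idealD => //.
by rewrite -mulNr; apply: left_idealM.
Qed.

End LeadingIdeals.

Theorem proposition4p2 (R : nzRingType) (n : nat)
    (R_PID : noncommutative_PID R)
    (R_max : infinite_set [set P : set R | maximal_ideal P]) :
  (forall lt : rel 'X_{1..n}, term_order lt ->
    amitsur_small_extension lt (@mpolyC n R : {rmorphism R -> {mpoly R[n]}})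
      (fun i : 'I_n => 'X_i : {mpoly R[n]})) /\
  (forall M : set {mpoly R[n]}, maximal_left_ideal M ->
    exists r : R, r != 0 /\ M r%:MP).
Proof.
split=> [lt lt_term|M [Mleft MT Mmax]].
  split; first by apply: mpoly_skew_polynomial_ring => //; case: R_PID.
  exists (fun _ => idfun); split; first exact: mpoly_structural_endomorphisms.
  move=> I Ileft sigma_I.
  (* With identity endomorphisms, stability under [sigma_pow] just says that the family ascends. *)
  have Imono i j : I i `<=` I (i + j)%MM.
    by move=> s Is; apply: (sigma_I i j); exists s; rewrite ?sigma_pow_id.
  have [r [r0 r_inv r_normal r_reg]] :=
    PID_normal_regular R_PID R_max Ileft Imono.
  exists r; split=> // [_ [f _ <-]|i s /=].
    by have [g ->] := mpoly_mulC_normal f r_normal; exists g.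
  by rewrite sigma_pow_id => /r_reg[a Ia eq_a]; exists a.
have [r [r0 r_inv r_normal r_reg]] := PID_normal_regular R_PID R_max
  (leading_ideal_left Mleft) (leading_ideal_mono Mleft).
have [Mr|nMr] := pselect (M r%:MP); first by exists r.
(* This is [M + S r], for [S] the polynomial ring; as [r] is outside [M], maximality makes it all of
   [S]. *)
pose J := [set f | exists2 m, M m & exists g, f = m + g * r%:MP].
have Jleft : left_ideal J.
  split=> [|a _ _ [m Mm [g ->]] [m' Mm' [g' ->]]].
    by exists 0; [exact: left_ideal0 | exists 0; rewrite mul0r addr0].
  exists (a * m + m'); first by case: Mleft => _; apply.
  by exists (a * g + g'); rewrite mulrDr mulrDl -mulrA addrACA.
have [m Mm [g eq1]] : J 1.
  have [|JM|->//] := Mmax J Jleft.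
    by move=> m Mm; exists m => //; exists 0; rewrite mul0r addr0.
  case: nMr; rewrite -JM; exists 0; first exact: left_ideal0.
  by exists 1; rewrite mul1r add0r.
have [||c Mc] := leading_ideal_elimination Mleft _ r_normal r_reg (g := g).
- by move=> a /(PID_mulf_eq0 R_PID)[//|/eqP]; rewrite (negPf r0).
- by rewrite eq1 addrK.
exists (1 - c * r); split=> //; apply/eqP => /eqP; rewrite subr_eq0 => /eqP cr1.
by apply: r_inv; exists c.
Qed.
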